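(* Let $n\ge 2$ and let $K_n=(V,E)$ be the complete graph with $n$ vertices $V=\{a_1,a_2,\dots,a_n\}$. Then $$\|M_{K_n}\|_2=\max_{k\in\{\lfloor n/3\rfloor,\ \lceil n/3\rceil\}}\left(1-\frac{k}{2n}+\frac{(4kn-3k^2)^{1/2}}{2n}\right)^{1/2}.$$
   Context: For a finite connected graph $G=(V,E)$, let $d_G(u,v)$ be the number of edges in a shortest path connecting $u$ and $v$, and let $B(e,r)=\{m\in V: d_G(e,m)\le r\}$. For $f:V\to\mathbb{R}$ the centered Hardy–Littlewood maximal function is $$M_Gf(e)=\max_{r\ge 0}\frac{1}{|B(e,r)|}\sum_{m\in B(e,r)}|f(m)|,\qquad e\in V.$$ With $\|g\|_2=\big(\sum_{e\in V}|g(e)|^2\big)^{1/2}$ for $g:V\to\mathbb{R}$, define $$\|M_G\|_2=\sup_{f:V\to\mathbb{R},\ f\ne0}\frac{\|M_Gf\|_2}{\|f\|_2}.$$ $\lfloor x\rfloor$ is the largest integer $\le x$ and $\lceil x\rceil$ is the smallest integer $\ge x$. *)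

(* Defs.v *)
From HB Require Import structures.
From mathcomp Require Import all_boot all_order all_algebra.
From mathcomp Require Import classical_sets reals.

Set Implicit Arguments.
Unset Strict Implicit.
Unset Printing Implicit Defensive.

Import Order.TTheory GRing.Theory Num.Theory.
Local Open Scope ring_scope.

Record connected_graph := ConnectedGraph {
  vertex :> finType;
  adj : rel vertex;
  adj_sym : symmetric adj;
  adj_irr : irreflexive adj;
  adj_connected : forall u v : vertex, connect adj u v
}.

Definition walk_of_length (G : connected_graph) (u v : G) (k : nat) : bool :=
  [exists p : k.-tuple G, path (@adj G) u p && (last u p == v)].

Lemma walk_exists (G : connected_graph) (u v : G) :
  exists k, walk_of_length u v k.
Proof.
have /connectP [p pth ->] := adj_connected u v.
by exists (size p); apply/existsP; exists (in_tuple p); rewrite pth eqxx.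
Qed.

Definition graph_dist (G : connected_graph) (u v : G) : nat :=
  ex_minn (walk_exists u v).

(* The radius is real, hence the cast of the distance. *)
Definition graph_ball (R : realType) (G : connected_graph) (e : G) (r : R)
    : {set G} :=
  [set m : G | (graph_dist e m)%:R <= r]%SET.

Definition ball_average (R : realType) (G : connected_graph)
    (f : {ffun G -> R}) (e : G) (r : R) : R :=
  (#|graph_ball e r|%:R)^-1 * \sum_(m in graph_ball e r) `|f m|.

(* The supremum is a maximum: as r ranges over the nonnegative reals,
   graph_ball e r takes only finitely many values. *)
Definition maximal_function (R : realType) (G : connected_graph)
    (f : {ffun G -> R}) : {ffun G -> R} :=
  [ffun e => sup [set ball_average f e r | r in [set r : R | 0 <= r]]%classic].

Definition l2_norm (R : realType) (V : finType) (g : {ffun V -> R}) : R :=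
  Num.sqrt (\sum_(e : V) `|g e| ^+ 2).

(* The set below is bounded above for every G, so the convention that sup is 0
   on unbounded sets plays no role. *)
Definition maximal_norm2 (R : realType) (G : connected_graph) : R :=
  sup [set l2_norm (maximal_function f) / l2_norm f
        | f in [set f : {ffun G -> R} | f != 0]]%classic.

Definition complete_adj (n : nat) : rel 'I_n := fun i j => i != j.

Lemma complete_adj_sym (n : nat) : symmetric (@complete_adj n).
Proof. by move=> i j; rewrite /complete_adj eq_sym. Qed.

Lemma complete_adj_irr (n : nat) : irreflexive (@complete_adj n).
Proof. by move=> i; rewrite /complete_adj eqxx. Qed.

Lemma complete_adj_connected (n : nat) (i j : 'I_n) :
  connect (@complete_adj n) i j.
Proof. by have [->|neq_ij] := eqVneq i j; [exact: connect0 | exact: connect1]. Qed.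

Definition complete_graph (n : nat) : connected_graph :=
  ConnectedGraph (@complete_adj_sym n) (@complete_adj_irr n)
    (@complete_adj_connected n).

Definition extremal_value (R : realType) (n : nat) (k : int) : R :=
  Num.sqrt (1 - k%:~R / (2 * n%:R)
            + Num.sqrt (4 * k%:~R * n%:R - 3 * k%:~R ^+ 2) / (2 * n%:R)).

(* Main.v *)
Require Import Defs.
From mathcomp Require Import all_boot all_order all_algebra.
From mathcomp Require Import classical_sets reals.
From mathcomp Require Import ring lra zify.

Set Implicit Arguments.
Unset Strict Implicit.
Unset Printing Implicit Defensive.

Import Order.TTheory GRing.Theory Num.Theory.
Local Open Scope ring_scope.

(** In the complete graph every ball is a singleton or the whole vertex set, so
    [M f e] is the larger of [|f e|] and the mean [m] of [|f|]. If [S] is the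
    set of vertices where [|f|] is at least [m], and [k = #|S|], then
      [|M f|^2 = \sum_(S) |f|^2 + (n - k) * m^2],
    and for any other choice of [S] the right-hand side is at most [|M f|^2].
    Hence the squared norm is the maximum over [k] of the
    largest eigenvalue of this quadratic form in [|f|], which is the identity
    on [S] plus a rank-one form.

    Write the eigenvalue as [1 + t / n]. The form is bounded by it as soon as
      [k * n <= t^2 + k * t + k^2],
    by Cauchy-Schwarz with weight [t] on [S] and [n + t] off [S]
    ([cutoff_energy_le]). When equality holds, the bound is reached by the
    function inversely proportional to these weights, [n + t] on [S] and [t]
    off [S] ([complete_maximal_energy_ge]). So if some [t > 0] satisfies the
    inequality for all [k] and the equality for one of them, the squared norm is
    [1 + t / n] ([complete_norm2_of_root]).

    The larger root [excess n k] of [t^2 + k * t + k^2 = k * n] gives exactly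
    the value in the theorem. On this ellipse [t] is largest at [k = n / 3]; in
    quantitative form, a root for [k = j] satisfies the inequality for all
    [k <= j] if [j <= n / 3], and for all [k >= j] if [j >= n / 3]. Every
    integer is at most the floor or at least the ceiling of [n / 3], hence the
    larger of the two roots satisfies the inequality for all [k]. *)

(** * The maximal function of the complete graph *)

Lemma sup_attained (R : realType) (A : set R) (x y : R) :
  ubound A x -> A y -> x <= y -> sup A = x.
Proof.
move=> Ax Ay xy; apply/eqP; rewrite eq_le; apply/andP; split.
  by apply: ge_sup => //; exists y.
by apply: le_trans xy _; apply: ub_le_sup => //; exists x.
Qed.

Lemma complete_graph_dist (n : nat) (i j : complete_graph n) :
  graph_dist i j = (i != j).
Proof.
rewrite /graph_dist; case: ex_minnP => k.
have [<-|neq] := eqVneq i j.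
  move=> _ /(_ 0%N) min_k; apply/eqP; rewrite -leqn0; apply: min_k.
  by apply/existsP; exists [tuple]; rewrite /= eqxx.
case: k => [|k] walk min_k.
  by move: walk neq => /existsP[p]; rewrite tuple0 /= => ->.
apply/eqP; rewrite eqn_leq /= andbT; apply: min_k.
by apply/existsP; exists [tuple j]; rewrite /= andbT eqxx andbT; exact: neq.
Qed.

Lemma complete_maximal_function (R : realType) (n : nat)
    (f : {ffun complete_graph n -> R}) (e : complete_graph n) :
  maximal_function f e =
    Num.max `|f e| (n%:R^-1 * \sum_(m : complete_graph n) `|f m|).
Proof.
have small (r : R) : 0 <= r < 1 -> ball_average f e r = `|f e|.
  move=> /andP[r0 r1].
  have -> : ball_average f e r = #|[set e]|%:R^-1 * \sum_(m in [set e]) `|f m|.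
    rewrite /ball_average; suff -> : graph_ball e r = [set e] by [].
    apply/setP => m; rewrite !inE complete_graph_dist eq_sym.
    by case: eqP => _; rewrite /= ?r0 // leNgt r1.
  by rewrite cards1 big_set1 invr1 mul1r.
have large (r : R) : 1 <= r ->
    ball_average f e r = n%:R^-1 * \sum_(m : complete_graph n) `|f m|.
  move=> r1; rewrite /ball_average.
  have -> : graph_ball e r = [set: complete_graph n].
    apply/setP => m; rewrite !inE complete_graph_dist.
    by apply: le_trans r1; rewrite lern1 leq_b1.
  rewrite cardsT card_ord; congr (_ * _).
  by apply: eq_bigl => m; rewrite inE.
rewrite ffunE.
(* Radius 0 or 1, whichever ball has the larger average. *)
pose r0 : R := if `|f e| < n%:R^-1 * \sum_(m : complete_graph n) `|f m|
               then 1 else 0.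
have r0_ge0 : 0 <= r0 by rewrite /r0; case: ifP.
apply: (@sup_attained _ _ _ (ball_average f e r0)); last 2 first.
- by exists r0.
- rewrite /r0 maxEge leNgt; case: ltP => _ /=; first by rewrite large.
  by rewrite small // lexx ltr01.
move=> _ [r /= r_ge0 <-]; rewrite le_max.
have [r1|r1] := ltP r 1; first by rewrite small ?r_ge0 // lexx.
by rewrite large // lexx orbT.
Qed.

(** * The quadratic form of a cutoff set *)

(** Weighted Cauchy-Schwarz, the weights being [t] on [S] and [n + t] off [S]:
    after moving [\sum_(S) h^2] to the right the claim is
    [n * (n - k) * mean^2 <= \sum_v w v * h v ^ 2], and the hypothesis on [t]
    says precisely that [(n - k) * \sum_v (w v)^-1 <= n]. *)
Lemma cutoff_energy_le (R : realType) (V : finType) (S : {set V}) (h : V -> R)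
    (t : R) :
  let n : R := #|V|%:R in
  let k : R := #|S|%:R in
  let mean := n^-1 * \sum_v h v in
  (0 < #|V|)%N -> 0 < t -> k * n <= t ^+ 2 + k * t + k ^+ 2 ->
  \sum_(v in S) h v ^+ 2 + \sum_(v in ~: S) mean ^+ 2
    <= (1 + t / n) * \sum_v h v ^+ 2.
Proof.
move=> n k mean V_gt0 t0 kt.
have n0 : 0 < n by rewrite ltr0n.
have cardC : #|~: S|%:R = n - k.
  by rewrite /n /k -(cardsC S) natrD addrC addKr.
have kn : 0 <= n - k by rewrite -cardC ler0n.
(* With this [c], summing [2 * c * h v <= w v * h v ^ 2 + c ^ 2 / w v] over all
   vertices gives the bound without dividing by the sum of the [1 / w v]. *)
pose c := (n - k) * mean.
have AMGM (w x : R) : 0 < w -> 2 * c * x <= w * x ^+ 2 + c ^+ 2 / w.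
  move=> w0; rewrite -subr_ge0.
  have -> : w * x ^+ 2 + c ^+ 2 / w - 2 * c * x = (w * x - c) ^+ 2 / w.
    by field; rewrite gt_eqF.
  by rewrite divr_ge0 ?sqr_ge0 // ltW.
have sumS : 2 * c * \sum_(v in S) h v
    <= t * \sum_(v in S) h v ^+ 2 + k * (c ^+ 2 / t).
  have -> : k * (c ^+ 2 / t) = \sum_(v in S) c ^+ 2 / t.
    by rewrite sumr_const mulr_natl.
  rewrite !mulr_sumr -big_split /=.
  by apply: ler_sum => v _; apply: AMGM.
have sumT : 2 * c * \sum_(v in ~: S) h v
    <= (n + t) * \sum_(v in ~: S) h v ^+ 2 + (n - k) * (c ^+ 2 / (n + t)).
  have -> : (n - k) * (c ^+ 2 / (n + t)) = \sum_(v in ~: S) c ^+ 2 / (n + t).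
    by rewrite sumr_const -cardC mulr_natl.
  rewrite !mulr_sumr -big_split /=.
  by apply: ler_sum => v _; apply: AMGM; apply: addr_gt0.
have split_sum (g : V -> R) :
    \sum_v g v = \sum_(v in S) g v + \sum_(v in ~: S) g v.
  rewrite (bigID (mem S)) /=; congr (_ + _).
  by apply: eq_bigl => v; rewrite inE.
have sE : n * mean = \sum_(v in S) h v + \sum_(v in ~: S) h v.
  by rewrite -split_sum /mean mulVKf ?gt_eqF.
rewrite split_sum sumr_const -mulr_natl cardC.
move: sumS sumT sE.
set a := \sum_(v in S) h v; set b := \sum_(v in ~: S) h v.
set A := \sum_(v in S) h v ^+ 2; set B := \sum_(v in ~: S) h v ^+ 2.
move=> sumS sumT sE.
have weights : k * (c ^+ 2 / t) + (n - k) * (c ^+ 2 / (n + t))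
    <= n * (n - k) * mean ^+ 2.
  have -> : k * (c ^+ 2 / t) + (n - k) * (c ^+ 2 / (n + t))
     = n * (n - k) * mean ^+ 2 * (((n - k) * (k + t)) / (t * (n + t))).
    by rewrite /c; field; rewrite !gt_eqF // addr_gt0.
  apply: ler_piMr; first by rewrite mulr_ge0 ?sqr_ge0 // mulr_ge0 // ltW.
  rewrite ler_pdivrMr ?mulr_gt0 ?addr_gt0 // mul1r.
  by move: kt; lra.
have cross : 2 * c * a + 2 * c * b = 2 * (n * (n - k) * mean ^+ 2).
  by rewrite -mulrDr -sE /c; ring.
have -> : (1 + t / n) * (A + B) = A + (t * A + (n + t) * B) / n.
  by field; rewrite gt_eqF.
rewrite lerD2l ler_pdivlMr //.
by move: sumS sumT weights cross; lra.
Qed.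

(** The eigenvalue equation tested on the function equal to [n + t] at [k]
    points and [t] at the other [n - k], whose mean is [k + t]: the condition on
    [t] is equivalent to [(n - k) * (k + t) = t * (n + t)]. *)
Lemma two_level_energy (R : realType) (n k t : R) :
  t ^+ 2 + k * t + k ^+ 2 = k * n ->
  n * (k * (n + t) ^+ 2 + (n - k) * (k + t) ^+ 2)
    = (n + t) * (k * (n + t) ^+ 2 + (n - k) * t ^+ 2).
Proof.
move=> kt.
have E : (n - k) * (k + t) = t * (n + t) by move: kt; lra.
have -> : (n - k) * (k + t) ^+ 2 = t * (n + t) * (k + t) by rewrite -E; ring.
ring.
Qed.

(** * The norm from a root of the characteristic equation *)

(** The cutoff set is where the maximal function is attained by radius 0. Its
    size depends on [f], which is why the inequality is needed for every [k]. *)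
Lemma complete_maximal_energy_le (R : realType) (n : nat) (t : R)
    (f : {ffun complete_graph n -> R}) :
  (0 < n)%N -> 0 < t ->
  (forall k : nat, (k <= n)%N ->
     k%:R * n%:R <= t ^+ 2 + k%:R * t + k%:R ^+ 2) ->
  \sum_e `|maximal_function f e| ^+ 2
    <= (1 + t / n%:R) * \sum_e `|f e| ^+ 2.
Proof.
move=> n_gt0 t0 ge_k.
pose mean := n%:R^-1 * \sum_(m : complete_graph n) `|f m|.
pose S : {set 'I_n} := [set e | mean <= `|f e|].
have cardV : #|complete_graph n| = n by rewrite card_ord.
have mean_ge0 : 0 <= mean by rewrite mulr_ge0 ?invr_ge0 ?ler0n ?sumr_ge0.
have S_le_n : (#|S| <= n)%N by have := max_card (mem S); rewrite card_ord.
have -> : \sum_e `|maximal_function f e| ^+ 2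
    = \sum_(e in S) `|f e| ^+ 2 + \sum_(e in ~: S) mean ^+ 2.
  rewrite (bigID (mem S)) /=; congr (_ + _).
    apply: eq_bigr => e; rewrite inE => mean_le.
    by rewrite complete_maximal_function max_l // normr_id.
  rewrite (eq_bigl (fun e => e \in ~: S)) => [|e]; last by rewrite !inE.
  apply: eq_bigr => e; rewrite !inE -ltNge => /ltW f_le.
  by rewrite complete_maximal_function max_r // ger0_norm.
have := @cutoff_energy_le R (complete_graph n) S (fun e => `|f e|) t.
by rewrite cardV; apply => //; exact: ge_k.
Qed.

(** The witness is [n + t] on [j] vertices and [t] on the others; its maximal
    function is at least [n + t] on the former and at least the mean [j + t] on
    the latter. *)
Lemma complete_maximal_energy_ge (R : realType) (n j : nat) (t : R) :
  (0 < n)%N -> (j <= n)%N -> 0 < t ->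
  t ^+ 2 + j%:R * t + j%:R ^+ 2 = j%:R * n%:R ->
  exists2 f : {ffun complete_graph n -> R}, f != 0 &
    (1 + t / n%:R) * \sum_e `|f e| ^+ 2
      <= \sum_e `|maximal_function f e| ^+ 2.
Proof.
move=> n_gt0 j_le_n t0 eq_j.
have n0 : 0 < n%:R :> R by rewrite ltr0n.
have nt0 : 0 < n%:R + t by exact: addr_gt0.
pose S : pred 'I_n := fun i => (i < j)%N.
have two_level_sum (x y : R) :
    \sum_(i < n) (if S i then x else y) = j%:R * x + (n%:R - j%:R) * y.
  rewrite -natrB // -(subnKC j_le_n) addKn in S *.
  rewrite big_split_ord /=; congr (_ + _).
    under eq_bigr => i _ do rewrite /S /= ltn_ord.
    by rewrite sumr_const card_ord mulr_natl.
  under eq_bigr => i _ do rewrite /S /= ltnNge leq_addr /=.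
  by rewrite sumr_const card_ord mulr_natl.
pose f : {ffun complete_graph n -> R} :=
  [ffun i => if S i then n%:R + t else t].
have fE i : `|f i| = if S i then n%:R + t else t.
  by rewrite ffunE ger0_norm //; case: ifP => _; exact: ltW.
have meanE : n%:R^-1 * \sum_(i : complete_graph n) `|f i| = j%:R + t.
  rewrite (eq_bigr _ (fun i _ => fE i)) two_level_sum.
  by field; rewrite gt_eqF.
exists f.
  apply/eqP => /ffunP /(_ (Ordinal n_gt0)); rewrite !ffunE.
  by case: ifP => _ /eqP; rewrite gt_eqF.
have -> : \sum_e `|f e| ^+ 2
    = j%:R * (n%:R + t) ^+ 2 + (n%:R - j%:R) * t ^+ 2.
  rewrite -two_level_sum; apply: eq_bigr => i _.
  by rewrite fE; case: ifP.
have -> : 1 + t / n%:R = (n%:R + t) / n%:R by field; rewrite gt_eqF.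
rewrite mulrAC ler_pdivrMr // -two_level_energy // [leRHS]mulrC.
rewrite ler_wpM2l ?ler0n // -two_level_sum; apply: ler_sum => i _.
rewrite complete_maximal_function meanE fE.
have jt0 : 0 <= j%:R + t by rewrite addr_ge0 ?ler0n ?(ltW t0).
have nt_ge0 := ltW nt0.
by case: ifP => _; rewrite ler_sqr ?nnegrE //;
  apply: le_trans _ (ler_norm _); rewrite le_max lexx ?orbT.
Qed.

Lemma complete_norm2_of_root (R : realType) (n j : nat) (t : R) :
  (0 < n)%N -> (j <= n)%N -> 0 < t ->
  t ^+ 2 + j%:R * t + j%:R ^+ 2 = j%:R * n%:R ->
  (forall k : nat, (k <= n)%N ->
     k%:R * n%:R <= t ^+ 2 + k%:R * t + k%:R ^+ 2) ->
  maximal_norm2 R (complete_graph n) = Num.sqrt (1 + t / n%:R).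
Proof.
move=> n_gt0 j_le_n t0 eq_j ge_k.
have lam0 : 0 <= 1 + t / n%:R by rewrite addr_ge0 ?divr_ge0 // ltW.
have norm_gt0 (f : {ffun complete_graph n -> R}) : f != 0 -> 0 < l2_norm f.
  apply: contra_neqT; rewrite -leNgt /l2_norm => norm_le0.
  have sum_ge0 : 0 <= \sum_e `|f e| ^+ 2.
    by apply: sumr_ge0 => e _; exact: sqr_ge0.
  have sum0 : \sum_e `|f e| ^+ 2 = 0.
    by apply/eqP; rewrite eq_le sum_ge0 andbT -sqrtr_eq0 eq_le norm_le0 sqrtr_ge0.
  apply/ffunP => e; rewrite ffunE.
  move/eqP: sum0; rewrite psumr_eq0 => [/allP /(_ e)|i _]; last exact: sqr_ge0.
  by rewrite mem_index_enum => /(_ isT) /=; rewrite sqrf_eq0 normr_eq0 => /eqP.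
have [f f0 f_ge] := complete_maximal_energy_ge n_gt0 j_le_n t0 eq_j.
apply: (@sup_attained _ _ _ (l2_norm (maximal_function f) / l2_norm f)).
- move=> _ [g /= g0 <-]; rewrite ler_pdivrMr ?norm_gt0 //.
  rewrite /l2_norm -sqrtrM // ler_wsqrtr //.
  exact: complete_maximal_energy_le.
- by exists f.
- rewrite ler_pdivlMr ?norm_gt0 // /l2_norm -sqrtrM //.
  exact: ler_wsqrtr.
Qed.

(** * Optimizing the size of the cutoff set *)

(** The larger root [t] of [t ^ 2 + k * t + k ^ 2 = k * n]. *)
Definition excess (R : realType) (n k : R) : R :=
  (Num.sqrt (4 * k * n - 3 * k ^+ 2) - k) / 2.

Lemma extremal_value_excess (R : realType) (n k : nat) : (0 < n)%N ->
  extremal_value R n k%:Z = Num.sqrt (1 + excess n%:R k%:R / n%:R).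
Proof.
move=> n_gt0; rewrite /extremal_value /excess -!pmulrn; congr Num.sqrt.
by field; rewrite pnatr_eq0 -lt0n.
Qed.

Lemma excess_root (R : realType) (n k : R) : 0 <= k <= n ->
  excess n k ^+ 2 + k * excess n k + k ^+ 2 = k * n.
Proof.
move=> /andP[k0 kn]; rewrite /excess.
set s := Num.sqrt _.
have s2 : s ^+ 2 = 4 * k * n - 3 * k ^+ 2 by rewrite sqr_sqrtr //; nra.
have -> : ((s - k) / 2) ^+ 2 + k * ((s - k) / 2) + k ^+ 2
  = (s ^+ 2 + 3 * k ^+ 2) / 4 by field.
by rewrite s2; field.
Qed.

Lemma excess_ge0 (R : realType) (n k : R) : 0 <= k <= n -> 0 <= excess n k.
Proof.
move=> /andP[k0 kn]; rewrite divr_ge0 // subr_ge0.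
by rewrite -[leLHS](ger0_norm k0) -sqrtr_sqr ler_wsqrtr //; nra.
Qed.

(** Subtracting the equation for [j] leaves [(j - k) * (n - t - k - j)]. The
    second factor is nonnegative because every root satisfies [t <= n / 3]: if
    [t > n / 3], then [t^2 + j * t + j^2 - j * n > (j - n / 3)^2]. *)
Lemma root_bound_below_third (R : realType) (n k j t : R) :
  0 <= k -> k <= j -> 3 * j <= n ->
  t ^+ 2 + j * t + j ^+ 2 = j * n -> k * n <= t ^+ 2 + k * t + k ^+ 2.
Proof.
move=> k0 kj jn eq_j.
have t_le : 3 * t <= n.
  rewrite leNgt; apply/negP => t_gt.
  have := sqr_ge0 (3 * j - n); nra.
rewrite -subr_ge0.
have -> : t ^+ 2 + k * t + k ^+ 2 - k * n = (j - k) * (n - t - k - j).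
  have -> : t ^+ 2 = j * n - j * t - j ^+ 2 by rewrite -eq_j; ring.
  ring.
by rewrite mulr_ge0 //; lra.
Qed.

(** Subtracting the equation for [j] leaves [(k - j) * (t + k + j - n)], and
    [t + 2 * j >= n]: if [t < n - 2 * j], then
    [t^2 + j * t + j^2 - j * n < (n - j) * (n - 3 * j) <= 0]. *)
Lemma root_bound_above_third (R : realType) (n k j t : R) :
  0 <= t -> j <= k -> n <= 3 * j ->
  t ^+ 2 + j * t + j ^+ 2 = j * n -> k * n <= t ^+ 2 + k * t + k ^+ 2.
Proof.
move=> t0 jk jn eq_j.
have t_ge : n <= t + 2 * j.
  rewrite leNgt; apply/negP => t_lt; nra.
rewrite -subr_ge0.
have -> : t ^+ 2 + k * t + k ^+ 2 - k * n = (k - j) * (t + k + j - n).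
  have -> : t ^+ 2 = j * n - j * t - j ^+ 2 by rewrite -eq_j; ring.
  ring.
by rewrite mulr_ge0 //; lra.
Qed.

Theorem theorem4 (R : realType) (n : nat) (n_ge2 : (2 <= n)%N) :
  maximal_norm2 R (complete_graph n) =
  Num.max (extremal_value R n (Num.floor (n%:R / 3 : R)))
          (extremal_value R n (Num.ceil (n%:R / 3 : R))).
Proof.
have n_gt0 : (0 < n)%N by exact: ltnW.
have n0 : 0 < n%:R :> R by rewrite ltr0n.
pose j0 := (n %/ 3)%N; pose j1 := ((n + 2) %/ 3)%N.
have j0_n : (3 * j0 <= n)%N by rewrite /j0; lia.
have n_j0 : (n < 3 * j0.+1)%N by rewrite /j0; lia.
have n_j1 : (n <= 3 * j1)%N by rewrite /j1; lia.
have j1_n : (3 * j1 < n + 3)%N by rewrite /j1; lia.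
have floorE : Num.floor (n%:R / 3 : R) = j0%:Z.
  apply: floor_def; rewrite ler_pdivlMr // ltr_pdivrMr //.
  by rewrite -[in X in _ && X]PoszD -!pmulrn -!natrM ler_nat ltr_nat; lia.
have ceilE : Num.ceil (n%:R / 3 : R) = j1%:Z.
  apply: ceil_def; rewrite ler_pdivrMr // ltr_pdivlMr //.
  rewrite rmorphB /= -!pmulrn mulrBl mul1r ltrBlDr.
  by rewrite -natrD -!natrM ler_nat ltr_nat; lia.
rewrite floorE ceilE !extremal_value_excess //.
set t0 := excess _ _; set t1 := excess _ _.
have j0_le : (j0 <= n)%N by lia.
have j1_le : (j1 <= n)%N by lia.
have range k : (k <= n)%N -> 0 <= (k%:R : R) <= n%:R by rewrite ler0n ler_nat.
have t0_ge0 : 0 <= t0 by exact/excess_ge0/range.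
have t1_ge0 : 0 <= t1 by exact/excess_ge0/range.
have eq0 := excess_root (range _ j0_le).
have eq1 := excess_root (range _ j1_le).
have -> : Num.max (Num.sqrt (1 + t0 / n%:R)) (Num.sqrt (1 + t1 / n%:R))
    = Num.sqrt (1 + Num.max t0 t1 / n%:R).
  case: (leP t0 t1) => t01.
    by rewrite max_r // ler_wsqrtr // lerD2l ler_pM2r ?invr_gt0.
  by rewrite max_l // ler_wsqrtr // lerD2l ler_pM2r ?invr_gt0 // ltW.
set t := Num.max t0 t1.
have t0t : t0 <= t by rewrite le_max lexx.
have t1t : t1 <= t by rewrite le_max lexx orbT.
have mono (k u : R) : 0 <= k -> 0 <= u -> u <= t ->
    k * n%:R <= u ^+ 2 + k * u + k ^+ 2 -> k * n%:R <= t ^+ 2 + k * t + k ^+ 2.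
  by move=> k0 u0 ut; nra.
have cert (k : nat) : (k <= n)%N ->
    k%:R * n%:R <= t ^+ 2 + k%:R * t + k%:R ^+ 2.
  move=> k_n; have [k_j0|j0_k] := leqP k j0.
    apply: (mono _ t0) => //.
    apply: (@root_bound_below_third _ _ _ j0%:R) => //; first by rewrite ler_nat.
    by rewrite -natrM ler_nat.
  apply: (mono _ t1) => //.
  apply: (@root_bound_above_third _ _ _ j1%:R) => //; rewrite -?natrM ler_nat //.
  by lia.
have t_gt0 : 0 < t.
  (* At [k = 1] the inequality with [t = 0] would read [n <= 1]. *)
  rewrite lt_neqAle le_max t0_ge0 andbT eq_sym; apply/eqP => tz.
  have := cert 1%N n_gt0; rewrite tz.
  have : (2 : R) <= n%:R by rewrite ler_nat.
  by lra.
have [j j_n eq_j] : exists2 j, (j <= n)%N &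
    t ^+ 2 + j%:R * t + j%:R ^+ 2 = j%:R * n%:R.
  by rewrite /t; case: (leP t0 t1) => _; [exists j1 | exists j0].
exact: complete_norm2_of_root j_n t_gt0 eq_j cert.
Qed.
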